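(* Let $A$ be a (possibly unbounded) self-adjoint operator on a Hilbert space $\mathcal{H}$ and let $\mathcal{L}$ be a finite dimensional subspace of $\mathrm{Dom}(A)$. If $z \in \mathrm{Spec}_2(A,\mathcal{L})$, then $$\mathrm{Spec}(A)\cap[\operatorname{Re} z - |\operatorname{Im} z|,\ \operatorname{Re} z + |\operatorname{Im} z|]\neq\varnothing .$$
   Context: Hilbert spaces are complex. $\mathrm{Dom}(A)$ and $\mathrm{Spec}(A)$ are the domain and spectrum of $A$, and $(\cdot,\cdot)$ is the scalar product of $\mathcal{H}$, linear in the first argument and conjugate-linear in the second. Second order relative spectrum: a number $z\in\mathbb{C}$ belongs to $\mathrm{Spec}_2(A,\mathcal{L})$, the second order spectrum of $A$ relative to $\mathcal{L}$, if there exists $u\in\mathcal{L}\setminus\{0\}$ such that $$\bigl((A-zI)u,\,(A-\overline{z}I)v\bigr)=0\qquad\text{for all } v\in\mathcal{L}.$$ *)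

(* Defs.v *)
From HB Require Import structures.
From mathcomp Require Import all_boot all_order all_algebra sesquilinear.
From mathcomp Require Import complex.
From mathcomp Require Import boolp classical_sets reals topology normedtype.

Set Implicit Arguments.
Unset Strict Implicit.
Unset Printing Implicit Defensive.

Import Order.TTheory GRing.Theory Num.Theory.
Import numFieldNormedType.Exports.

Local Open Scope classical_set_scope.
Local Open Scope ring_scope.

(* A (possibly unbounded) linear operator. The underlying function is total,
   but only its values on the domain are meaningful: linearity is required on
   the domain only, and nothing below uses values outside of it. *)
Record unbounded_operator (K : pzRingType) (H : lmodType K) := UnboundedOperator {
  op_fun :> H -> H ;
  dom : set H ;
  dom_submod : submod_closed (mem dom) ;
  op_linear : forall (a : K) (u v : H), dom u -> dom v ->
    op_fun (a *: u + v) = a *: op_fun u + op_fun v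
}.

Definition finite_dim_subspace (K : pzRingType) (H : lmodType K) (L : set H) :=
  exists (n : nat) (e : 'I_n -> H),
    L = [set u | exists c : 'I_n -> K, u = \sum_(i < n) c i *: e i].

Section hilbert.
Context {R : realType} {H : completeNormedModType R[i]}.
Implicit Type A : unbounded_operator H.

(* The complete norm of H is the one induced by the scalar product; the type
   {dot H for Num.conj} makes it linear in the first argument and
   conjugate-linear in the second. *)
Definition hilbert_product (dot : {dot H for Num.conj}) :=
  forall u : H, `|u| ^+ 2 = dot u u.

Definition op_graph A : set (H * H) := [set p | dom A p.1 /\ A p.1 = p.2].

(* Graph of the adjoint, which is single-valued when dom A is dense. *)
Definition adjoint_graph (dot : {dot H for Num.conj}) A : set (H * H) :=
  [set p | forall u, dom A u -> dot (A u) p.1 = dot u p.2].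

Definition self_adjoint (dot : {dot H for Num.conj}) A :=
  dense (dom A) /\ adjoint_graph dot A = op_graph A.

(* z such that A - zI : dom A -> H has an everywhere defined bounded inverse. *)
Definition resolvent_set A : set R[i] :=
  [set z | exists B : {linear H -> H},
    [/\ continuous B,
        forall v, dom A (B v) /\ A (B v) - z *: B v = v
      & forall u, dom A u -> B (A u - z *: u) = u]].

Definition spectrum A : set R[i] := ~` resolvent_set A.

Definition spectrum2 (dot : {dot H for Num.conj}) A (L : set H) : set R[i] :=
  [set z | exists u, [/\ L u, u != 0
    & forall v, L v -> dot (A u - z *: u) (A v - z^* *: v) = 0]].

End hilbert.

(* Main.v *)
(* Let a = Re z, b = Im z. Testing the defining relation against v = u and
   taking real parts gives |(A - a)u| = |b| |u|. If [a - |b|, a + |b|] missed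
   the spectrum, then B = (A - a)^-1 would be bounded and symmetric with
   |B| >= 1/|b|. Put l = 1/|B| <= |b|. As a - l and a + l are not in the
   spectrum, 1 + l B and 1 - l B are bounded below, which is impossible for a
   symmetric operator of norm 1/l. *)

Require Import Defs.
From HB Require Import structures.
From mathcomp Require Import all_boot all_order all_algebra sesquilinear.
From mathcomp Require Import complex.
From mathcomp Require Import boolp classical_sets reals topology normedtype.
From mathcomp Require Import ring lra.

Set Implicit Arguments.
Unset Strict Implicit.
Unset Printing Implicit Defensive.

Import Order.TTheory GRing.Theory Num.Theory.
Import numFieldNormedType.Exports.

Local Open Scope classical_set_scope.
Local Open Scope ring_scope.

(** Multiplied by [x], both conjugations give the squared modulus of [x]. *)
Lemma conj_conjc (R : rcfType) (x : R[i]) : x^* = conjc x.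
Proof.
have [->|x0] := eqVneq x 0; first by rewrite conjC0 conjc0.
by apply: (mulfI x0); rewrite -sqr_normc normCK.
Qed.

Section real_form.
Context {R : realType} {H : completeNormedModType R[i]}
        (dot : {dot H for Num.conj}).
Implicit Types (u v w : H) (c : R).

(** The real part turns [H] into a real inner product space with the same squared norms, so that the
    estimates take place in [R]. *)
Definition rdot u v : R := complex.Re (dot u v).

Lemma rdotDl u v w : rdot (u + v) w = rdot u w + rdot v w.
Proof. by rewrite /rdot linearDl raddfD. Qed.

Lemma rdotC u v : rdot u v = rdot v u.
Proof. by rewrite /rdot hermC expr0 mul1r /= conj_conjc; case: (dot v u). Qed.

Lemma rdotDr u v w : rdot u (v + w) = rdot u v + rdot u w.
Proof. by rewrite rdotC rdotDl !(rdotC u). Qed.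

Lemma rdotZl c u v : rdot (c%:C%C *: u) v = c * rdot u v.
Proof.
rewrite /rdot linearZl_LR /=; case: (dot u v) => x y /=.
by rewrite mul0r subr0.
Qed.

Lemma rdotZr c u v : rdot u (c%:C%C *: v) = c * rdot u v.
Proof. by rewrite rdotC rdotZl rdotC. Qed.

Lemma rdot_ge0 u : 0 <= rdot u u.
Proof. by have := dnorm_ge0 dot u; rewrite lecE => /andP[_]. Qed.

Lemma rdot_gt0 u : u != 0 -> 0 < rdot u u.
Proof. by rewrite -(dnorm_gt0 dot) ltcE => /andP[_]. Qed.

Lemma dnormE u : dot u u = (rdot u u)%:C%C.
Proof. by rewrite /rdot RRe_real // ger0_real // dnorm_ge0. Qed.

Lemma rdot_subDD u v : rdot (u - v) (u + v) = rdot u u - rdot v v.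
Proof.
have -> : - v = (-1)%:C%C *: v by rewrite rmorphN scaleN1r.
rewrite !rdotDl !rdotDr !rdotZl (rdotC v u); ring.
Qed.

Lemma rdot_add_le u v :
  rdot (u + v) (u + v) <= 2 * rdot u u + 2 * rdot v v.
Proof.
have := rdot_ge0 (u + (-1)%:C%C *: v).
rewrite !rdotDl !rdotDr !rdotZl !rdotZr (rdotC v u); lra.
Qed.

Lemma continuous_rdot_bounded (B : {linear H -> H}) :
  hilbert_product dot -> continuous B ->
  exists2 K : R, 0 <= K & forall x, rdot (B x) (B x) <= K * rdot x x.
Proof.
move=> Hdot /linear_bounded_continuous /linear_boundedP [M [Mreal HM]].
(* [M] comes with a bound for every real constant above it; this one is also nonnegative, so the
   inequality can be squared. *)
have M1 : M < `|M| + 1.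
  by rewrite (le_lt_trans (real_ler_norm Mreal)) // ltrDl.
have {HM} HM := HM _ M1.
have /complex_realP[k Ek] : `|M| + 1 \is Num.real.
  by rewrite realD // ger0_real.
exists (k ^+ 2) => [|x]; first exact: sqr_ge0.
rewrite -lecR -dnormE -Hdot !rmorphM /= -dnormE -Hdot -expr2 -Ek -exprMn.
by rewrite lerXn2r // ?nnegrE ?mulr_ge0 // addr_ge0.
Qed.

(* The least K0 with |Bx|^2 <= K0 |x|^2 is |B|^2; were both 1 - l B and
   1 + l B bounded below for l = 1/|B|, so would be 1 - l^2 B^2, which is
   impossible as |x - l^2 B^2 x|^2 <= |x|^2 - l^2 |Bx|^2. *)
Lemma symmetric_norm_approx_eigenvalue (B : {linear H -> H}) (K : R) w (s : R) :
  (forall x y, dot (B x) y = dot x (B y)) ->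
  (forall x, rdot (B x) (B x) <= K * rdot x x) ->
  w != 0 -> 0 < s -> rdot w w <= s ^+ 2 * rdot (B w) (B w) ->
  exists2 l : R, 0 < l <= s &
    ~ ((exists2 D : R, 0 < D & forall x, rdot x x <=
          D * rdot (x - l%:C%C *: B x) (x - l%:C%C *: B x)) /\
       (exists2 D : R, 0 < D & forall x, rdot x x <=
          D * rdot (x - (- l)%:C%C *: B x) (x - (- l)%:C%C *: B x))).
Proof.
move=> Bsym HK w0 s0 sw.
have w_gt0 := rdot_gt0 w0.
pose S : set R := [set k | forall x, rdot (B x) (B x) <= k * rdot x x].
(* Testing on [w] gives |w|^2 <= s^2 |Bw|^2 <= s^2 k |w|^2. This makes the infimum positive and
   later yields [l <= s]. *)
have lbS : lbound S (s ^- 2).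
  move=> k /(_ w) Sk.
  rewrite -(ler_pM2r w_gt0) (le_trans _ Sk) //.
  by rewrite ler_pdivrMl // exprn_gt0.
have infS : has_inf S by split; [exists K | exists (s ^- 2)].
pose K0 := inf S.
have K0ge : s ^- 2 <= K0 by apply: lb_le_inf => //; exists K.
have K0_gt0 : 0 < K0 by rewrite (lt_le_trans _ K0ge) // invr_gt0 exprn_gt0.
(* The infimum is attained: for x != 0 the quotient |Bx|^2 / |x|^2 is a lower bound of [S]. *)
have SK0 x : rdot (B x) (B x) <= K0 * rdot x x.
  have [->|/rdot_gt0 x0] := eqVneq x 0.
    by rewrite linear0 /rdot linear0 mulr0.
  rewrite -ler_pdivrMr //; apply: lb_le_inf; first by exists K.
  by move=> k /(_ x) Sk; rewrite ler_pdivrMr.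
pose l := (Num.sqrt K0)^-1.
have l_gt0 : 0 < l by rewrite invr_gt0 sqrtr_gt0.
have lK : l ^+ 2 * K0 = 1.
  by rewrite exprVn sqr_sqrtr ?ltW // mulVf // gt_eqF.
exists l.
  rewrite l_gt0 -(ler_pXn2r (n:=2)) ?nnegrE ?(ltW l_gt0) ?(ltW s0) //=.
  by rewrite exprVn sqr_sqrtr ?(ltW K0_gt0) // invf_ple ?posrE ?exprn_gt0 //.
move=> [[D D0 HD] [D' D'0 HD']].
have E0 : 0 < D * D' by rewrite mulr_gt0.
have key x : rdot x x <= D * D' * (rdot x x - l ^+ 2 * rdot (B x) (B x)).
  apply: le_trans (HD x) _; rewrite -mulrA ler_pM2l //.
  apply: le_trans (HD' _) _; rewrite ler_pM2l //.
  (* (1 + lB)(1 - lB) = 1 - l^2 B^2. *)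
  have -> : x - l%:C%C *: B x - (- l)%:C%C *: B (x - l%:C%C *: B x) =
            x + (- l ^+ 2)%:C%C *: B (B x).
    rewrite !rmorphN rmorphXn /= !scaleNr opprK expr2 -scalerA.
    by rewrite (linearB B) (linearZ_LR B) scalerBr addrA addrNK.
  rewrite !rdotDl !rdotDr !rdotZl !rdotZr (rdotC (B (B x)) x).
  have -> : rdot x (B (B x)) = rdot (B x) (B x) by rewrite /rdot Bsym.
  (* With l^2 K0 = 1 this reads l^4 |B^2 x|^2 <= l^2 |Bx|^2. *)
  have := SK0 (B x); rewrite -(ler_pM2l (exprn_gt0 4 l_gt0)).
  have -> : l ^+ 4 * (K0 * rdot (B x) (B x)) = l ^+ 2 * rdot (B x) (B x).
    by rewrite -[RHS]mulr1 -lK; ring.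
  lra.
(* Multiplying [key] by [K0] puts into [S] a constant strictly below its infimum. *)
have SE : S (K0 - K0 / (D * D')).
  move=> x.
  have := key x; rewrite mulrC -ler_pdivrMr // => kx.
  have {}kx := ler_wpM2l (ltW K0_gt0) kx.
  have e : K0 * (rdot x x - l ^+ 2 * rdot (B x) (B x)) =
     K0 * rdot x x - (l ^+ 2 * K0) * rdot (B x) (B x) by ring.
  move: kx; rewrite e lK => kx.
  have e2 : (K0 - K0 / (D * D')) * rdot x x =
     K0 * rdot x x - K0 * (rdot x x / (D * D')) by ring.
  rewrite e2; lra.
have /(_ _ SE) := ge_inf (proj2 infS).
by rewrite lerBrDr gerDl leNgt divr_gt0.
Qed.

(** With w = f - (Re z)u and v = i(Im z)u, the two factors are w - v and w + v, and the real part of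
    their product is |w|^2 - |v|^2. *)
Lemma rdot_sub_Re_of_dot_eq0 (f u : H) (z : R[i]) :
  dot (f - z *: u) (f - z^* *: u) = 0 ->
  rdot (f - (complex.Re z)%:C%C *: u) (f - (complex.Re z)%:C%C *: u) =
  `|complex.Im z| ^+ 2 * rdot u u.
Proof.
set a := complex.Re z; set b := complex.Im z => uz.
pose c : R[i] := (0 +i* b)%C; pose w := f - a%:C%C *: u; pose v := c *: u.
have zac : z = a%:C%C + c.
  by apply/eqP; rewrite eq_complex /= addr0 add0r !eqxx.
have zE : f - z *: u = w - v.
  by rewrite /w /v -addrA -opprD -scalerDl -zac.
have zcE : f - z^* *: u = w + v.
  rewrite /w /v -addrA -[- _ + _]opprK opprD opprK -scalerBl.
  congr (_ - _ *: _).
  rewrite conj_conjc {1}zac; apply/eqP.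
  by rewrite eq_complex /= addr0 subr0 add0r sub0r !eqxx.
have vv : rdot v v = `|b| ^+ 2 * rdot u u.
  rewrite real_normK ?num_real //; apply: complexI.
  rewrite rmorphM /= -!dnormE dnormZ -add_Re2_Im2 /=.
  by rewrite expr0n add0r.
rewrite -vv; apply/eqP; rewrite -subr_eq0; apply/eqP.
transitivity (rdot (w - v) (w + v)); last by rewrite /rdot -zE -zcE uz.
by rewrite rdot_subDD.
Qed.

(** Write x = (A - a)Bx and y = (A - a)By, and move the symmetric A - a, with a real, across the
    product. *)
Lemma resolvent_symmetric (A : unbounded_operator H) (a : R)
    (B : {linear H -> H}) :
  self_adjoint dot A ->
  (forall v, dom A (B v) /\ A (B v) - a%:C%C *: B v = v) ->
  forall x y, dot (B x) y = dot x (B y).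
Proof.
move=> [_ Aadj] AB x y.
have [[dx Ax] [dy Ay]] := (AB x, AB y).
have : adjoint_graph dot A (B y, A (B y)) by rewrite Aadj.
move=> /(_ _ dx) /= Axy.
rewrite -{2}Ax -{1}Ay linearBr linearBl; congr (_ - _); first exact: esym.
by rewrite linearZr_LR linearZl_LR /= conj_conjc conjc_real.
Qed.

(** Since (A - a - l)Bx = x - lBx =: y, the resolvent C at a + l gives Bx = Cy. Hence x = y + lCy is
    controlled by y. *)
Lemma resolvent_bounded_below (A : unbounded_operator H) (a l : R)
    (B : {linear H -> H}) :
  hilbert_product dot ->
  (forall v, dom A (B v) /\ A (B v) - a%:C%C *: B v = v) ->
  resolvent_set A (a + l)%:C%C ->
  exists2 D : R, 0 < D & forall x, rdot x x <=
    D * rdot (x - l%:C%C *: B x) (x - l%:C%C *: B x).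
Proof.
move=> Hdot AB [C [Ccont _ CA]].
have [K K0 CK] := continuous_rdot_bounded Hdot Ccont.
exists (2 + 2 * l ^+ 2 * K) => [|x].
  by rewrite ltr_pwDl // mulr_ge0 // mulr_ge0 ?sqr_ge0.
have [dx Ax] := AB x; set y := x - _.
have Cy : C y = B x.
  by rewrite /y -{1}Ax -addrA -opprD -scalerDl -rmorphD; apply: CA.
have -> : rdot x x = rdot (y + l%:C%C *: B x) (y + l%:C%C *: B x).
  by rewrite addrNK.
apply: le_trans (rdot_add_le _ _) _; rewrite rdotZl rdotZr -Cy.
have := ler_wpM2l (sqr_ge0 l) (CK y); lra.
Qed.

End real_form.

Theorem theorem2p5 (R : realType) (H : completeNormedModType R[i])
  (dot : {dot H for Num.conj}) (A : unbounded_operator H) (L : set H) (z : R[i]) :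
  hilbert_product dot ->
  self_adjoint dot A ->
  finite_dim_subspace L ->
  L `<=` dom A ->
  spectrum2 dot A L z ->
  spectrum A `&`
    [set x%:C%C | x in `[complex.Re z - `|complex.Im z|,
                         complex.Re z + `|complex.Im z|]] !=set0.
Proof.
move=> Hdot Asa _ LA [u [Lu u0 /(_ u Lu) /rdot_sub_Re_of_dot_eq0]].
set a := complex.Re z; set s := `|complex.Im z|; set w := A u - _ => wE.
have s_ge0 : 0 <= s by exact: normr_ge0.
apply: contrapT => /set0P /negP; rewrite negbK => /eqP spec0.
have res x : - s <= x <= s -> resolvent_set A (a + x)%:C%C.
  move=> xs; apply: contrapT => nres.
  suff : set0 (a + x)%:C%C by [].
  rewrite -spec0; split=> //; exists (a + x) => //=.
  by rewrite in_itv /= !lerD2l.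
have /res : - s <= 0 <= s by rewrite oppr_le0 s_ge0.
rewrite addr0 => -[B [Bcont AB BA]].
have Bw : B w = u by apply: BA; exact: LA.
have w0 : w != 0 by apply: contra_neq u0 => w0; rewrite -Bw w0 linear0.
(* If s = 0, then |w| = s|u| = 0, although w != 0. *)
have s_gt0 : 0 < s.
  rewrite lt_neqAle s_ge0 andbT; apply/eqP => s0.
  by have := rdot_gt0 dot w0; rewrite wE -s0 expr0n mul0r ltxx.
have [K _ BK] := continuous_rdot_bounded Hdot Bcont.
have Bsym := resolvent_symmetric Asa AB.
(* As Bw = u, the required bound |w|^2 <= s^2 |Bw|^2 is an equality. *)
have [|l /andP[l0 ls]] := symmetric_norm_approx_eigenvalue Bsym BK w0 s_gt0.
  by rewrite Bw wE.
apply; split; apply: (resolvent_bounded_below Hdot AB); apply: res.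
  by rewrite ls andbT (le_trans _ (ltW l0)) // oppr_le0.
by rewrite lerN2 ls (le_trans _ s_ge0) // oppr_le0 ltW.
Qed.
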